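(* (a) Every semifield admits a pure characteristic, i.e. if $n$ is its characteristic then it is of pure characteristic $n$. (b) Every semifield of nonzero characteristic is a quasi-field. (c) Every quasi-field whose characteristic $p$ is different from $1$ is a field. The quasi-fields of characteristic $1$ are exactly the idempotent semifields.
   Context: A semiring $A$ is defined like a (unital, associative) ring except that $(A,+)$ is only required to be a commutative monoid with neutral element $0$ ($0$ being absorbing for multiplication). A semifield is a semiring $K$ such that $K\setminus\{0\}$ is a group under multiplication (multiplication is not assumed commutative; accordingly ''field'' here means a not necessarily commutative field, i.e. a semifield whose addition is a group law). It is idempotent if $x+x=x$ for all $x$. A commutative monoid $(G,+)$ is a quasi-group if for each $x\in G$ there is $y\in G$ with $x+y+x=x$ and $y+x+y=y$. A quasi-ring is a semiring whose additive monoid is a quasi-group. A quasi-field is a quasi-ring $K$ such that $K\setminus\{0\}$ is a group under multiplication. For a semiring $A$, the set $H=\{k\in\mathbb N: k\cdot 1+1=1\}$ equals $n\mathbb N$ for a unique $n\in\mathbb N$ (with $0\in\mathbb N$); this $n$ is the characteristic of $A$. A semiring $A$ is of pure characteristic $p$ if it has characteristic $p$ and, for every $x\neq 0$ in $A$ and every $k\in\mathbb N$, $(k+1)x=x$ implies that $p$ divides $k$. *)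

(* Defs.v *)
From mathcomp Require Import all_boot all_algebra.
From Stdlib Require Import Classical.

Set Implicit Arguments.
Unset Strict Implicit.
Unset Printing Implicit Defensive.

Import GRing.Theory.
Local Open Scope ring_scope.

(* Semirings are [pzSemiRingType]s: multiplication need not commute and
   [1 = 0] is allowed. Since a group is nonempty, [is_semifield] excludes the
   zero semiring. *)

Definition is_group_on (T : Type) (S : {pred T}) (op : T -> T -> T) : Prop :=
  [/\ {in S &, forall x y, op x y \in S},
      {in S & &, associative op}
    & exists2 e, e \in S &
        {in S, forall x, op e x = x /\ op x e = x} /\
        {in S, forall x, exists2 y, y \in S & op y x = e /\ op x y = e}].

Definition is_semifield (K : pzSemiRingType) : Prop :=
  is_group_on (predC1 (0 : K)) *%R.

Definition is_field (K : pzSemiRingType) : Prop :=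
  is_semifield K /\ is_group_on (@predT K) +%R.

Definition is_idempotent (A : pzSemiRingType) : Prop :=
  forall x : A, x + x = x.

Definition is_quasi_group (G : nmodType) : Prop :=
  forall x : G, exists y : G, x + y + x = x /\ y + x + y = y.

Definition is_quasi_ring (A : pzSemiRingType) : Prop := is_quasi_group A.

Definition is_quasi_field (K : pzSemiRingType) : Prop :=
  is_quasi_ring K /\ is_group_on (predC1 (0 : K)) *%R.

(* Says that [{k | k 1 + 1 = 1} = n N]; note that [0 %| k] means [k = 0].
   Unlike for [[pchar A]], the value [n] need not be prime and can be [1]. *)
Definition has_characteristic (A : pzSemiRingType) (n : nat) : Prop :=
  forall k : nat, 1 *+ k + 1 = 1 :> A <-> (n %| k)%N.

Definition has_pure_characteristic (A : pzSemiRingType) (p : nat) : Prop :=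
  has_characteristic A p /\
  forall (x : A) (k : nat), x != 0 -> x *+ k.+1 = x -> (p %| k)%N.

Lemma characteristic_exists_unique (A : pzSemiRingType) :
  exists! n : nat, has_characteristic A n.
Proof.
pose H k := 1 *+ k + 1 == 1 :> A.
have HD k l : H k -> H (l + k)%N = H l.
  by rewrite /H mulrnDr -addrA => /eqP ->.
have HM k q : H k -> H (q * k)%N.
  move=> Hk; elim: q => [|q IHq]; first by rewrite /H mul0n mulr0n add0r.
  by rewrite mulSn addnC HD.
have [n nP] : exists n, has_characteristic A n.
  case: (classic (exists k, (0 < k)%N && H k)) => [exH|noH].
    case: (ex_minnP exH) => n /andP[n_gt0 Hn] n_min; exists n => k.
    split=> [/eqP Hk | /dvdnP[q ->]]; last by apply/eqP; apply: HM.
    rewrite /dvdn eqn0Ngt; apply/negP => r_gt0.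
    have Hr : H (k %% n)%N.
      by rewrite -(HD _ (k %% n)%N (HM _ (k %/ n)%N Hn)) addnC -divn_eq.
    have := n_min (k %% n)%N; rewrite r_gt0 Hr leqNgt ltn_mod n_gt0.
    by move/(_ isT).
  exists 0%N => k; rewrite dvd0n; split=> [/eqP Hk | /eqP ->].
    by rewrite eqn0Ngt; apply/negP => k_gt0; apply: noH; exists k; rewrite k_gt0.
  by rewrite mulr0n add0r.
exists n; split=> // m mP; apply/eqP; rewrite eqn_dvd.
by apply/andP; split; [apply/nP/mP | apply/mP/nP].
Qed.

(* Main.v *)
Require Import Defs.
From mathcomp Require Import all_boot all_algebra.

Import GRing.Theory.

(** For (c): if [y] is a quasi-inverse of [1], then [e = 1 + y] satisfies
    [e + e = e].  If [e = 0], then [1], hence every element, has an opposite;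
    otherwise dividing by [e] gives [1 + 1 = 1], that is, characteristic [1]. *)

Section Semirings.
Local Open Scope ring_scope.

(** [is_group_on] only provides some neutral element of the nonzero elements. It must be [1],
    because [1] is itself nonzero: otherwise [e = 1 * e] would vanish. *)
Lemma semifield_neutralE {K : pzSemiRingType} {e : K} :
  e != 0 -> (forall x, x != 0 -> e * x = x) -> e = 1.
Proof.
move=> e0 eP; rewrite -[e]mulr1; apply: eP.
by apply: contra_neq e0 => one0; rewrite -[e]mul1r one0 mul0r.
Qed.

Lemma semifield_mulVx {K : pzSemiRingType} {x : K} :
  is_semifield K -> x != 0 -> exists y, y * x = 1.
Proof.
case=> _ _ [e e0 [eP eV]] x0; have [y _ [yx _]] := eV _ x0; exists y.
by rewrite yx; apply: semifield_neutralE => // z /eP[].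
Qed.

(** Left multiplication by an inverse of [x] commutes with taking multiples, so it carries the
    relation from [x] to [1]. This yields (a), and for [k = 1] the division by [e] in (c). *)
Lemma semifield_mulrn_fix {K : pzSemiRingType} {x : K} {k} :
  is_semifield K -> x != 0 -> x *+ k.+1 = x -> 1 *+ k + 1 = 1 :> K.
Proof.
move=> Ksf x0 kx; have [y yx] := semifield_mulVx Ksf x0.
by rewrite -mulrSr -yx -mulrnAr kx.
Qed.

Lemma semifield_pure_characteristic {K : pzSemiRingType} {n} :
  is_semifield K -> has_characteristic K n -> has_pure_characteristic K n.
Proof.
by move=> Ksf nP; split=> // x k x0 kx; apply/nP; exact: semifield_mulrn_fix kx.
Qed.

(* With [p = n.+1], the quasi-inverse of [x] is [(2p - 1) x], since adding [p x]
   to a positive multiple of [x] does not change it. *)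
Lemma characteristic_gt0_quasi_ring {A : pzSemiRingType} {n} :
  has_characteristic A n.+1 -> is_quasi_ring A.
Proof.
move=> nP x.
have absorb m : x *+ (m.+1 + n.+1) = x *+ m.+1.
  have n1x : x *+ n.+1 + x = x.
    by rewrite -{2 3}[x]mulr1 -[x in x *+ _]mulr1 -mulrnAr -mulrDr
               (iffRL (nP n.+1) (dvdnn _)).
  by rewrite mulrnDr mulrS addrAC [x + _]addrC n1x.
exists (x *+ (n + n.+1)); split.
  have -> : x + x *+ (n + n.+1) + x = x *+ (1 + n.+1 + n.+1).
    by rewrite -mulrS -mulrSr; congr (_ *+ _); rewrite addnS !addSn.
  by rewrite add1n absorb -add1n absorb mulr1n.
(* With [p = n.+1] the sum has [4p - 1 = (2p - 1) + 2p] copies of [x], and absorbing [p] of them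
   twice leaves [2p - 1]. *)
have -> : x *+ (n + n.+1) + x + x *+ (n + n.+1)
        = x *+ ((n + n).+1 + n.+1 + n.+1).
  by rewrite -mulrSr -mulrnDr; congr (_ *+ _); rewrite !(addSn, addnS) !addnA.
by rewrite !absorb addnS.
Qed.

Lemma characteristic_dvd1 {A : pzSemiRingType} {p} :
  has_characteristic A p -> 1 + 1 = 1 :> A -> p = 1%N.
Proof. by move=> pP A11; apply/eqP; rewrite -dvdn1; apply/pP. Qed.

(** By distributivity, [y * x] is an opposite of [x]. *)
Lemma opp1_additive_group {A : pzSemiRingType} {y : A} :
  1 + y = 0 -> is_group_on (@predT A) +%R.
Proof.
move=> y1; split=> //; first by move=> a b c _ _ _; exact: addrA.
exists 0 => //; split=> x _; first by rewrite add0r addr0.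
have xy : x + y * x = 0 by rewrite -{1}[x]mul1r -mulrDl y1 mul0r.
by exists (y * x) => //; rewrite [y * x + x]addrC.
Qed.

Lemma quasi_field_is_field {K : pzSemiRingType} {p} :
  is_quasi_field K -> has_characteristic K p -> p <> 1%N -> is_field K.
Proof.
move=> [Kqr Ksf] pP p1; split=> //.
have [y [y1 _]] := Kqr 1.
have [/opp1_additive_group//|e0] := eqVneq (1 + y) 0.
case: p1; apply: characteristic_dvd1 pP _.
(* Here [e + e = (1 + y + 1) + y = 1 + y = e] by the choice of [y]. *)
by apply: (semifield_mulrn_fix (k := 1%N) Ksf e0); rewrite mulr2n addrA y1.
Qed.

(** Both sides amount to [1 + 1 = 1]: multiplying by [x] gives idempotence, and conversely all
    positive multiples of [1] collapse to [1], so every [k] is a period. *)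
Lemma idempotent_characteristicP {A : pzSemiRingType} :
  has_characteristic A 1 <-> is_idempotent A.
Proof.
split=> [A1 x | Aid k]; first by rewrite -[x]mulr1 -mulrDr (iffRL (A1 1%N)).
by rewrite dvd1n -mulrSr; split=> // _; elim: k => // k IHk; rewrite mulrS IHk.
Qed.

Lemma idempotent_quasi_ring {A : pzSemiRingType} :
  is_idempotent A -> is_quasi_ring A.
Proof. by move=> Aid x; exists x; rewrite !Aid. Qed.

End Semirings.

Theorem proposition2 :
  (* (a) *)
  (forall K : pzSemiRingType, is_semifield K ->
     (exists n : nat, has_pure_characteristic K n) /\
     (forall n : nat, has_characteristic K n -> has_pure_characteristic K n)) /\
  (* (b) *)
  (forall (K : pzSemiRingType) (n : nat),
     is_semifield K -> has_characteristic K n -> n <> 0 ->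
     is_quasi_field K) /\
  (* (c) *)
  (forall (K : pzSemiRingType) (p : nat),
     is_quasi_field K -> has_characteristic K p -> p <> 1 ->
     is_field K) /\
  (forall K : pzSemiRingType,
     is_quasi_field K /\ has_characteristic K 1 <->
     is_semifield K /\ is_idempotent K).
Proof.
split; [|split; [|split]].
- move=> K Ksf; split=> [|n]; last exact: semifield_pure_characteristic.
  have [n [nP _]] := characteristic_exists_unique K.
  by exists n; exact: semifield_pure_characteristic.
- by move=> K [|n] // Ksf nP _; split=> //; exact: characteristic_gt0_quasi_ring nP.
- by move=> K p; exact: quasi_field_is_field.
- move=> K; split=> [[[_ Ksf] /idempotent_characteristicP]|[Ksf Kid]] //.
  split; last exact/idempotent_characteristicP.
  by split=> //; exact: idempotent_quasi_ring.
Qed.
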